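(* $\mathfrak{ros}_{01}(c_0)=\min(\mathfrak{d},\mathfrak{r})$.
   Context: $\mathfrak{ros}_{01}(c_0)$ is the minimal cardinality of a family $\mathcal{G}$ of infinite subsets of $\mathbb{N}$ such that for every finite-to-one function $f:\mathbb{N}\to\mathbb{N}$ with no fixed points there is $A\in\mathcal{G}$ with $f[A]\cap A=\emptyset$. $\mathfrak{d}$ is the dominating number (minimal size of a family of functions $\mathbb{N}\to\mathbb{N}$ such that every function $\mathbb{N}\to\mathbb{N}$ is eventually dominated by a member of the family). The reaping number $\mathfrak{r}$ is the minimal cardinality of a family $\mathcal{F}$ of infinite subsets of $\mathbb{N}$ such that there is no $S\subseteq\mathbb{N}$ with $F\cap S$ and $F\setminus S$ both infinite for all $F\in\mathcal{F}$. *)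

(* Defs.v *)
From mathcomp Require Import all_boot.
From mathcomp Require Import boolp classical_sets functions cardinality filter.

Set Implicit Arguments.
Unset Strict Implicit.
Unset Printing Implicit Defensive.

Local Open Scope classical_set_scope.
Local Open Scope card_scope.

(* A cardinal is represented by a class of pairwise equipotent types, so that  *)
(* equality of cardinals is Leibniz equality of classes.                       *)
Definition cardinal := set Type.

Definition cardinality_of (T : Type) (A : set T) : cardinal :=
  [set X : Type | [set: X] #= A].

Definition cardinal_le (k l : cardinal) : Prop :=
  exists X Y : Type, [/\ k X, l Y & [set: X] #<= [set: Y]].

Definition cardinal_min (k l : cardinal) : cardinal :=
  if `[< cardinal_le k l >] then k else l.

(* This is cardinality_of A for any A of least cardinality among the sets      *)
(* satisfying P; min_cardinalityP below shows that such an A exists as soon as *)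
(* some set satisfies P.                                                       *)
Definition min_cardinality (T : Type) (P : set (set T)) : cardinal :=
  [set X : Type | exists A : set T,
    [/\ P A, forall B, P B -> A #<= B & [set: X] #= A]].

Lemma exists_least_cardinality (T : Type) (P : set (set T)) :
  P !=set0 -> exists2 A, P A & forall B, P B -> A #<= B.
Proof.
move=> [A0 PA0].
have [P0|P0] := pselect (P set0).
  by exists set0 => // B _; exact: card_ge0.
have neP A : P A -> exists x, A x.
  move=> PA; apply/set0P/eqP => A0E; apply: P0; by rewrite -A0E.
have [x0 _] := neP _ PA0.
(* S is a set of simultaneous choices with injective projections *)
pose ok (S : set (set T -> T)) :=
  (forall f, S f -> forall A, P A -> A (f A)) /\
  (forall f g A, S f -> S g -> P A -> f A = g A -> f = g).
have [S [[okS1 okS2] maxS]] : exists S, ok S /\ forall S', S `<` S' -> ~ ok S'.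
  apply: (@Zorn_bigcup _ ok) => F Fok totF; split.
    by move=> f [S FS Sf] A PA; exact: ((Fok _ FS).1 f Sf A PA).
  move=> f g A [S FS Sf] [S' FS' S'g] PA fg.
  have [SS'|S'S] := totF _ _ FS FS'.
    exact: ((Fok _ FS').2 f g A (SS' _ Sf) S'g PA fg).
  exact: ((Fok _ FS).2 f g A Sf (S'S _ S'g) PA fg).
have [[A [PA AS]]|nA] := pselect (exists A, P A /\
    A `<=` (fun f : set T -> T => f A) @` S).
  exists A => // B PB; apply: card_le_trans (subset_card_le AS) _.
  apply: card_le_trans (card_image_le _ _) _.
  have injB : {in S &, injective (fun f : set T -> T => f B)}.
    by move=> f g /set_mem Sf /set_mem Sg; exact: (okS2 f g B Sf Sg PB).
  rewrite -(card_le_eql (inj_card_eq injB)); apply: subset_card_le.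
  by move=> _ [f Sf <-]; exact: (okS1 f Sf B PB).
have new A : exists x, P A -> A x /\ forall f, S f -> f A <> x.
  have [PA|nPA] := pselect (P A); last by exists x0.
  apply: contrapT => H; apply: nA; exists A; split => // x Ax.
  apply: contrapT => nx; apply: H; exists x => _; split => // f Sf fx.
  by apply: nx; exists f.
have [h hP] := choice new.
exfalso; apply: (maxS (S `|` [set h])).
  split; first by left.
  move=> /(_ h) Sh; exact: ((hP _ PA0).2 h (Sh (or_intror erefl))).
split=> [f [Sf|->] A PA|f g A [Sf|->] [Sg|->] PA fg].
- exact: (okS1 f Sf A PA).
- by have [] := hP _ PA.
- exact: (okS2 f g A Sf Sg PA fg).
- by case: ((hP _ PA).2 f Sf).
- by case: ((hP _ PA).2 g Sg).
- by [].
Qed.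

Lemma min_cardinalityP (T : Type) (P : set (set T)) : P !=set0 ->
  exists A, [/\ P A, forall B, P B -> A #<= B
    & min_cardinality P = cardinality_of A].
Proof.
move=> /exists_least_cardinality[A PA Amin]; exists A; split => //.
apply/seteqP; split=> X /= => [[B [PB Bmin XB]]|XA]; last by exists A.
apply: (card_eq_trans XB); rewrite card_eq_le.
by rewrite (Bmin _ PA) (Amin _ PB).
Qed.

Definition finite_to_one (f : nat -> nat) : Prop :=
  forall n, finite_set (f @^-1` [set n]).

Definition ros01_c0_family (G : set (set nat)) : Prop :=
  (forall A, G A -> infinite_set A) /\
  forall f : nat -> nat, finite_to_one f -> (forall n, f n <> n) ->
    exists2 A, G A & f @` A `&` A = set0.

Definition dominating_family (D : set (nat -> nat)) : Prop :=
  forall g : nat -> nat, exists2 f, D f & \forall n \near \oo, g n <= f n.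

Definition reaping_family (F : set (set nat)) : Prop :=
  (forall A, F A -> infinite_set A) /\
  ~ exists S : set nat, forall A, F A ->
      infinite_set (A `&` S) /\ infinite_set (A `\` S).

Definition ros01_c0 : cardinal := min_cardinality ros01_c0_family.
Definition dominating_number : cardinal := min_cardinality dominating_family.
Definition reaping_number : cardinal := min_cardinality reaping_family.

(* Main.v *)
From mathcomp Require Import all_boot zify.
From mathcomp Require Import boolp classical_sets functions cardinality filter.
Require Import Defs.

(* Upper bounds. If h eventually bounds f and the size of its fibres, a set    *)
(* whose gaps exceed h is disjoint from its f-image after removing an initial  *)
(* segment. For a reaping family F, color the graph of f with two bits and     *)
(* reap twice: first the first bit, by A in F, then the second bit read along  *)
(* an enumeration e_A of A, by B in F; a tail of e_A[B] is then monochromatic. *)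
(* Both constructions keep the cardinality because k * k = k for infinite k.   *)
(* Lower bound. Let G be a ros_01(c_0) family having no reaping image.         *)
(* Splitting G infinitely often gives c : nat -> nat whose fibres all meet     *)
(* every A in G in an infinite set, and f = c would satisfy f[A] = nat for     *)
(* every A in G. If moreover G has no dominating image, each fibre can be      *)
(* truncated at a bound h so that f is finite-to-one and still f[A] meets A.   *)

Set Implicit Arguments.
Unset Strict Implicit.
Unset Printing Implicit Defensive.

Local Open Scope classical_set_scope.
Local Open Scope card_scope.

(** Two bits suffice for reaping because [x] and [f x] always differ in one of them
    ([functional_graph_coloring]): edges that go down are coloured by recursion, edges that go up
    form a forest. So a set monochromatic in both bits misses its image. The three inequalities are
    [ros01_le_dominating], [ros01_le_reaping] and [ros01_ge]. The upper bounds count index sets by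
    [card_setX_le], proved with Zorn's lemma and applicable by [dominating_infinite] and
    [reaping_infinite]. In the lower bound, the families that must fail to be dominating or reaping
    are images of [G], hence no larger than [G]. *)

(** * Injections and comparability of cardinals *)

Lemma card_le_of_inj T U (A : set T) (B : set U) (f : T -> U) :
  (forall x, A x -> B (f x)) ->
  (forall x y, A x -> A y -> f x = f y -> x = y) -> A #<= B.
Proof.
move=> fAB finj.
have /injfunPex[g] : exists2 f : T -> U, set_fun A B f & set_inj A f.
  by exists f => // x y /set_mem Ax /set_mem Ay; exact: finj.
exact: inj_card_le.
Qed.

Lemma card_le_inj T (U : pointedType) (A : set T) (B : set U) : A #<= B ->
  exists f : T -> U, (forall x, A x -> B (f x)) /\
    (forall x y, A x -> A y -> f x = f y -> x = y).
Proof.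
move=> /pcard_leP/injfunPex[f fAB finj]; exists f; split => // x y Ax Ay.
by apply: finj; exact: mem_set.
Qed.

Lemma card_le_total T (A B : set T) : A #<= B \/ B #<= A.
Proof.
have [|X XAB Xmin] := @exists_least_cardinality T [set A; B].
  by exists A; left.
by case: XAB => <-; [left; apply: Xmin; right | right; apply: Xmin; left].
Qed.

(** * The square of an infinite cardinal *)

Section square.
Variables (T : pointedType) (A : set T).

(** Reading the domain off the diagonal makes it a function of [R], so Zorn's lemma can be applied
    to relations ordered by inclusion alone. *)
Definition sq_dom (R : set (T * T * T)) : set T :=
  [set x | exists z, R (x, x, z)].

(* R contains the graph of an injection of the square of its domain into the   *)
(* domain; single-valuedness is not required.                                  *)
Definition sq_graph (R : set (T * T * T)) : Prop :=
  [/\ forall x y, sq_dom R x -> sq_dom R y -> exists z, R (x, y, z),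
      forall x y z, R (x, y, z) ->
        [/\ sq_dom R x, sq_dom R y, sq_dom R z & A z]
    & forall p p' z, R (p, z) -> R (p', z) -> p = p'].

Lemma sq_domS R R' : R `<=` R' -> sq_dom R `<=` sq_dom R'.
Proof. by move=> RR' x [z Rz]; exists z; exact: RR'. Qed.

Lemma sq_graph_bigcup (F : set (set (T * T * T))) :
  (forall R, F R -> sq_graph R) -> total_on F subset ->
  sq_graph (\bigcup_(R in F) R).
Proof.
move=> gF totF.
have two R R' : F R -> F R' -> exists R'', [/\ F R'', R `<=` R'' & R' `<=` R''].
  move=> FR FR'; have [RR'|R'R] := totF _ _ FR FR'; first by exists R'; split.
  by exists R; split.
have subU R : F R -> R `<=` \bigcup_(R in F) R by move=> FR x Rx; exists R.
split.
- move=> x y [z [R FR Rxz]] [t [R' FR' Ryt]].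
  have [R'' [FR'' RR'' R'R'']] := two _ _ FR FR'.
  have [g _ _] := gF _ FR''.
  have [||u Ru] := g x y; first by exists z; exact: RR''.
    by exists t; exact: R'R''.
  by exists u, R''.
- move=> x y z [R FR Rxyz]; have [_ /(_ _ _ _ Rxyz)[Rx Ry Rz Az] _] := gF _ FR.
  by split => //; apply: sq_domS (subU _ FR) _ _.
- move=> p p' z [R FR Rpz] [R' FR' Rpz'].
  have [R'' [FR'' RR'' R'R'']] := two _ _ FR FR'.
  have [_ _ g] := gF _ FR''.
  exact: (g _ _ _ (RR'' _ Rpz) (R'R'' _ Rpz')).
Qed.

Lemma sq_graph_nat (e : nat -> T) : (forall n, A (e n)) -> injective e ->
  exists2 R, sq_graph R & forall n, sq_dom R (e n).
Proof.
move=> eA einj.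
pose c : nat * nat -> nat := pickle.
have cinj : injective c := pcan_inj pickleK.
pose R := [set t | exists m n, t = (e m, e n, e (c (m, n)))].
have De n : sq_dom R (e n) by exists (e (c (n, n))), n, n.
exists R => //; split.
- move=> x y [z [m [_ [-> _ _]]]] [t [n [_ [-> _ _]]]].
  by exists (e (c (m, n))), m, n.
- by move=> x y z [m [n [-> -> ->]]]; split.
- by move=> p p' z [m [n [-> ->]]] [m' [n' [-> /einj/cinj[-> ->]]]].
Qed.

Lemma sq_graph_inj R : sq_graph R -> exists i : T * T -> T,
  (forall x y, sq_dom R x -> sq_dom R y -> R (x, y, i (x, y))) /\
  (forall x y x' y', sq_dom R x -> sq_dom R y -> sq_dom R x' -> sq_dom R y' ->
    i (x, y) = i (x', y') -> x = x' /\ y = y').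
Proof.
move=> [g1 g2 g3].
have /choice[i iP] (p : T * T) : exists z, sq_dom R p.1 -> sq_dom R p.2 -> R (p, z).
  have [[D1 D2]|nD] := pselect (sq_dom R p.1 /\ sq_dom R p.2).
    by have [z Rz] := g1 _ _ D1 D2; exists z; case: p D1 D2 Rz.
  by exists point => D1 D2; case: nD.
exists i; split => [x y Dx Dy|x y x' y' Dx Dy Dx' Dy' E]; first exact: iP.
have := iP (x, y) Dx Dy; rewrite E => /g3/(_ (iP (x', y') Dx' Dy')).
by case.
Qed.

(** The domain [B] has a disjoint copy [C] in [A]. Pairs from [B] and [C] outside the square of [B]
    are sent into [C]: fold both coordinates back to [B] by [p], record their sides by one of four
    tags in [B], pack all this with [i], and shift by [j]. *)
Lemma sq_graph_extend R (e : nat -> T) : sq_graph R ->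
  injective e -> (forall n, sq_dom R (e n)) -> sq_dom R #<= A `\` sq_dom R ->
  exists2 R', R `<` R' & sq_graph R'.
Proof.
move=> gR einj eD /card_le_inj[j [jA jinj]].
have [i [iR iinj]] := sq_graph_inj gR.
have [g1 g2 g3] := gR.
set B := sq_dom R in eD jA jinj iR iinj g1 g2 *.
have iB x y : B x -> B y -> B (i (x, y)).
  by move=> Bx By; have [] := g2 _ _ _ (iR _ _ Bx By).
pose C := j @` B.
have CB x : C x -> ~ B x by move=> [b /jA[_ nBj] <-].
have /choice[p pP] x : exists b, (B x -> b = x) /\ (C x -> B b /\ j b = x).
  have [Bx|nBx] := pselect (B x); first by exists x; split => // /CB.
  have [[b Bb bx]|nCx] := pselect (C x); first by exists b; split.
  by exists x; split.
have pB x : B x \/ C x -> B (p x).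
  by have [pB pC] := pP x; move=> [Bx|/pC[]//]; rewrite pB.
pose b2n x : nat := `[< B x >].
have pinj x y : B x \/ C x -> B y \/ C y -> b2n x = b2n y -> p x = p y -> x = y.
  move=> BCx BCy; rewrite /b2n; have [px px'] := pP x; have [py py'] := pP y.
  case: asboolP => Bx; case: asboolP => By // _.
    by rewrite px// py.
  case: BCx => // /px'[_ jx]; case: BCy => // /py'[_ jy] pxy.
  by rewrite -jx -jy pxy.
pose t x y := e (b2n x + (b2n y).*2).
pose psi x y := j (i (t x y, i (p x, p y))).
pose N := [set s : T * T * T | exists x y,
  [/\ B x \/ C x, B y \/ C y, ~ (B x /\ B y) & s = (x, y, psi x y)]].
have psiB x y : B x \/ C x -> B y \/ C y -> B (i (t x y, i (p x, p y))).
  by move=> BCx BCy; apply: (iB) (eD _) (iB _ _ (pB _ _) (pB _ _)).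
have psiC x y : B x \/ C x -> B y \/ C y -> C (psi x y).
  by move=> BCx BCy; exists (i (t x y, i (p x, p y))) => //; exact: psiB.
have DN x : C x -> (R `|` N) (x, x, psi x x).
  move=> Cx; right; exists x, x; split; [by right|by right| |by []].
  by move=> [/(CB _ Cx)].
have D' x : sq_dom (R `|` N) x <-> B x \/ C x.
  split=> [[z [Rz|[y [_ [BCy _ _ [-> _ _]]]]]]//|].
    by left; exists z.
  by move=> [[z Rz]|Cx]; [exists z; left|exists (psi x x); exact: DN].
exists (R `|` N).
  split; first by left.
  move=> sub; have Cj : C (j (e 0%N)) by exists (e 0%N).
  have /sub/g2[Bj _ _ _] := DN _ Cj; exact: CB Bj.
split.
- move=> x y /D' BCx /D' BCy; have [[Bx By]|nB] := pselect (B x /\ B y).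
    by exists (i (x, y)); left; exact: iR.
  by exists (psi x y); right; exists x, y.
- move=> x y z [/g2[Bx By Bz Az]|[x' [y' [BCx BCy nB [-> -> ->]]]]].
    by split => //; apply/D'; left.
  split; [exact/D'|exact/D'|by apply/D'; right; exact: psiC|].
  by case: (jA _ (psiB _ _ BCx BCy)).
- have RN q z : R (q, z) -> forall x y, B x \/ C x -> B y \/ C y -> z <> psi x y.
    case: q => a b /g2[_ _ Bz _] x y BCx BCy zE.
    by apply: CB Bz; rewrite zE; exact: psiC.
  move=> q q' z [Rq|[x [y [BCx BCy nB [-> ->]]]]].
    move=> [/(g3 _ _ _ Rq)//|[x [y [BCx BCy nB [_ zE]]]]].
    by case: (RN _ _ Rq _ _ BCx BCy).
  move=> [/RN/(_ _ _ BCx BCy)//|[x' [y' [BCx' BCy' nB' [-> E]]]]].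
  have /iinj := jinj _ _ (psiB _ _ BCx BCy) (psiB _ _ BCx' BCy') E.
  move=> /(_ (eD _) (iB _ _ (pB _ BCx) (pB _ BCy))).
  move=> /(_ (eD _) (iB _ _ (pB _ BCx') (pB _ BCy')))[/einj tE].
  move=> /(iinj _ _ _ _ (pB _ BCx) (pB _ BCy) (pB _ BCx') (pB _ BCy'))[px py].
  have [bx b_y] : b2n x = b2n x' /\ b2n y = b2n y'.
    by move: tE; rewrite /b2n; do 4 case: `[< _ >].
  by rewrite (pinj _ _ BCx BCx' bx px) (pinj _ _ BCy BCy' b_y py).
Qed.

Lemma card_setX_le : infinite_set A -> A `*` A #<= A.
Proof.
move=> /infiniteP/card_le_inj[e [eA einj0]].
have {}eA n : A (e n) by exact: eA.
have {einj0}einj : injective e by move=> m n; exact: einj0.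
have [R0 gR0 eR0] := sq_graph_nat eA einj.
(* Adjoining [R0] makes the empty chain admissible and keeps the range of [e] inside every
   domain. *)
pose ok R := sq_graph (R0 `|` R).
have [R [okR maxR]] : exists R, ok R /\ forall R', R `<` R' -> ~ ok R'.
  apply: (@Zorn_bigcup _ ok) => F Fok totF.
  pose F' := [set R0] `|` [set R0 `|` R | R in F].
  rewrite /ok; suff -> : R0 `|` \bigcup_(R in F) R = \bigcup_(R in F') R.
    apply: sq_graph_bigcup => [R [->//|[R' FR' <-]]|]; first exact: Fok.
    move=> _ _ [->|[R1 FR1 <-]] [->|[R2 FR2 <-]]; [by left|by left|by right|].
    by have [R12|R21] := totF _ _ FR1 FR2; [left|right]; exact: setUS.
  apply/seteqP; split=> x.
    by move=> [R0x|[R FR Rx]]; [exists R0 => //; left|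
      exists (R0 `|` R); [right; exists R|right]].
  by move=> [_ [->|[R FR <-]]]; [left|move=> [|Rx]; [left|right; exists R]].
have eR n : sq_dom (R0 `|` R) (e n) by exact: sq_domS (@subsetUl _ _ _) _ (eR0 n).
have [AB|BA] := card_le_total (A `\` sq_dom (R0 `|` R)) (sq_dom (R0 `|` R));
  last first.
  have [R' [RR' nR'R] gR'] := sq_graph_extend okR einj eR BA.
  exfalso; apply: (maxR R').
    split; first by apply: subset_trans RR'; exact: subsetUr.
    by move=> R'R; apply: nR'R => x /R'R; right.
  rewrite /ok ((setUidPr R0 R').2 _)//; apply: subset_trans RR'.
  exact: subsetUl.
have [i [iR iinj]] := sq_graph_inj okR.
have [u [uB uinj]] := card_le_inj AB.
set B := sq_dom _ in eR iR iinj uB uinj.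
have iB x y : B x -> B y -> B (i (x, y)).
  by have [_ g _] := okR; move=> Bx By; have [] := g _ _ _ (iR _ _ Bx By).
(* By maximality the rest of [A] embeds in [B]; the tags [e 0] and [e 1] then embed all of [A] in
   [B], whose square embeds in [B]. *)
pose v x := if `[< B x >] then i (e 0%N, x) else i (e 1%N, u x).
have vB x : A x -> B (v x).
  rewrite /v; case: asboolP => Bx Ax; apply: iB => //; exact: uB.
have vinj x y : A x -> A y -> v x = v y -> x = y.
  rewrite /v => Ax Ay; case: asboolP => Bx; case: asboolP => By.
  - by move=> /iinj[].
  - by move=> /iinj[||||/einj]//; exact: uB.
  - by move=> /iinj[||||/einj]//; exact: uB.
  - by move=> /iinj[||||_ /uinj]//; [exact: uB|exact: uB|exact].
apply: (card_le_of_inj (f := fun q => i (v q.1, v q.2))).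
  move=> [x y] /= [Ax Ay]; have [_ g _] := okR.
  by have [] := g _ _ _ (iR _ _ (vB _ Ax) (vB _ Ay)).
move=> [x y] [x' y'] /= [Ax Ay] [Ax' Ay'] /iinj[||||]; try exact: vB.
by move=> /(vinj _ _ Ax Ax') -> /(vinj _ _ Ay Ay') ->.
Qed.

End square.

Lemma card_setX_nat_le (T : pointedType) (A : set T) :
  infinite_set A -> A `*` [set: nat] #<= A.
Proof.
move=> Ainf; apply: card_le_trans (card_setX_le Ainf).
have /infiniteP/card_le_inj[e [eA einj]] := Ainf.
apply: (card_le_of_inj (f := fun q => (q.1, e q.2))).
  by move=> [x n] /= [Ax _]; split => //; exact: eA.
by move=> [x n] [y m] /= _ _ [-> /einj->].
Qed.

(** * Unbounded sets of naturals; dominating and reaping families are infinite *)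

Lemma finite_uniform_bound (T : eqType) (D : set T) (P : T -> nat -> Prop) :
  finite_set D ->
  (forall x m n, m <= n -> P x m -> P x n) ->
  (forall x, D x -> exists n, P x n) -> exists n, forall x, D x -> P x n.
Proof.
move=> /finite_seqP[s ->] Pmono; elim: s => [|x s IH] Ps; first by exists 0.
have [|n nP] := IH; first by move=> y ys; apply: Ps; rewrite /= inE ys orbT.
have [|m mP] := Ps x; first by rewrite /= mem_head.
exists (maxn m n) => y; rewrite /= inE => /orP[/eqP->|/nP].
  by apply: Pmono mP; rewrite leq_maxl.
by apply: Pmono; rewrite leq_maxr.
Qed.

Lemma infinite_natP (A : set nat) :
  infinite_set A <-> forall n, exists2 x, A x & n <= x.
Proof.
split=> [Ainf n|Aunb /finite_uniform_bound].
  apply: contrapT => nA; apply: Ainf.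
  apply: (@sub_finite_set _ _ `I_n) (finite_II n) => x Ax /=.
  by rewrite ltnNge; apply/negP => nx; apply: nA; exists x.
move=> /(_ (fun x n => x < n)) []; first by move=> x m n mn xm; exact: leq_trans xm mn.
  by move=> x _; exists x.+1.
by move=> n An; have [x /An] := Aunb n; lia.
Qed.

Lemma infinite_enum (A : set nat) : infinite_set A ->
  exists e : nat -> nat, (forall n, A (e n)) /\ injective e.
Proof.
move=> /infiniteP/card_le_inj[e [eA einj]].
by exists e; split=> [n|m n]; [exact: eA|exact: einj].
Qed.

Lemma dominating_infinite D : dominating_family D -> infinite_set D.
Proof.
move=> domD finD.
have /choice[g gP] (n : nat) : exists N, forall f, D f -> f n < N.
  apply: (finite_uniform_bound finD) => [f N N' NN' fN|f _].
    exact: leq_trans fN NN'.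
  by exists (f n).+1.
have [f Df [N _ Nf]] := domD g.
by have := gP N f Df; have := Nf N (leqnn N); lia.
Qed.

(** If [F] were finite, [nat] could be cut into consecutive intervals each meeting every member of
    [F]; the union of those of even index would split them all. *)
Lemma reaping_infinite F : reaping_family F -> infinite_set F.
Proof.
move=> [Finf Fsplit] finF.
have /choice[h hP] (n : nat) : exists m, forall A, F A -> exists2 x, A x & n <= x < m.
  apply: (finite_uniform_bound finF) => [A m m' mm' [x Ax xm]|A FA].
    by exists x => //; lia.
  have [x Ax nx] := (infinite_natP A).1 (Finf _ FA) n.
  by exists x.+1, x => //; lia.
pose b k := iter k (fun n => maxn n.+1 (h n)) 0.
have bS k : b k < b k.+1 by rewrite /b iterS; lia.
have bmono i j : i <= j -> b i <= b j.
  by elim: j => [|j IH]; [case: i|rewrite leq_eqVlt => /orP[/eqP->//|/IH]; have := bS j; lia].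
have bge k : k <= b k by elim: k => // k IH; exact: leq_ltn_trans IH (bS k).
have bhit A k : F A -> exists2 x, A x & b k <= x < b k.+1.
  move=> /(hP (b k))[x Ax xb]; exists x => //.
  by rewrite /b iterS -/(b k); lia.
apply: Fsplit; exists [set x | exists k, b k.*2 <= x < b k.*2.+1] => A FA.
split; apply/infinite_natP => n.
  have [x Ax xb] := bhit A n.*2 FA.
  by exists x; [split => //; exists n|have := bge n.*2; lia].
have [x Ax xb] := bhit A n.*2.+1 FA.
exists x; last by have := bge n.*2.+1; lia.
split=> // -[k kx]; have [kn|nk] := leqP k n.
  by have := bmono k.*2.+1 n.*2.+1; lia.
by have := bmono n.*2.+2 k.*2; lia.
Qed.

(** * The bound by the dominating number *)

Lemma sparse_set (h : nat -> nat) N : exists A : set nat,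
  [/\ infinite_set A, forall x, A x -> N <= x
    & forall x y, A x -> A y -> x < y -> h x < y].
Proof.
pose a k := iter k (fun n => (maxn n (h n)).+1) N.
have aS k : a k < a k.+1 by rewrite /a iterS; lia.
have hS k : h (a k) < a k.+1 by rewrite /a iterS; lia.
have amono i j : i <= j -> a i <= a j.
  by elim: j => [|j IH]; [case: i|rewrite leq_eqVlt => /orP[/eqP->//|/IH]; have := aS j; lia].
have age k : k <= a k by elim: k => // k IH; exact: leq_ltn_trans IH (aS k).
exists (range a); split.
- by apply/infinite_natP => n; exists (a n) => //; exists n.
- by move=> _ [k _ <-]; exact: (amono 0).
- move=> _ _ [i _ <-] [j _ <-] aij; have [ji|ij] := leqP j i.
    by have := amono _ _ ji; lia.
  exact: leq_trans (hS i) (amono _ _ ij).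
Qed.

(** The two conjuncts exclude [f x] from a sparse set containing [x] when [f x] lies above,
    respectively below, [x]; finite fibres give the second. *)
Lemma finite_to_one_bound f : finite_to_one f ->
  exists g : nat -> nat, forall i m, (i <= m -> f i <= g m) /\ (f i <= m -> i <= g m).
Proof.
move=> ff.
have /choice[u uP] n : exists N, forall i, f i = n -> i <= N.
  apply: (finite_uniform_bound (ff n)) => [i N N' NN' iN|i _]; last by exists i.
  exact: leq_trans iN NN'.
exists (fun m => \max_(i < m.+1) maxn (f i) (u i)) => i m.
have B k : k <= m -> maxn (f k) (u k) <= \max_(i < m.+1) maxn (f i) (u i).
  by rewrite -ltnS => km; apply: (leq_bigmax (Ordinal km)).
split=> [/B|/B]; first by lia.
by have := uP (f i) i erefl; lia.
Qed.

Lemma ros01_le_dominating D : dominating_family D ->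
  exists2 G, ros01_c0_family G & G #<= D.
Proof.
move=> domD.
have /choice[A AP] (q : (nat -> nat) * nat) := sparse_set q.1 q.2.
exists (A @` (D `*` [set: nat])); last first.
  apply: card_le_trans (card_image_le _ _) _.
  exact/card_setX_nat_le/dominating_infinite.
split=> [_ [q _ <-]|f ff fN]; first by have [] := AP q.
have [g gP] := finite_to_one_bound ff.
have [h Dh [N _ Nh]] := domD g.
exists (A (h, N)); first by exists (h, N).
have [_ geN sp] := AP (h, N).
apply/seteqP; split=> // y [[x Ax fxy] Ay].
have [xy|yx|xy] := ltngtP x y.
- have /= hy := sp _ _ Ax Ay xy; have /= gh := Nh _ (geN _ Ax).
  by have := (gP x x).1 (leqnn x); rewrite fxy; lia.
- have /= hx := sp _ _ Ay Ax yx; have /= gh := Nh _ (geN _ Ay).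
  by have := (gP x y).2; rewrite fxy leqnn => /(_ isT); lia.
- by apply: (fN x); rewrite fxy xy.
Qed.

(** * Two-bit colourings and the bound by the reaping number *)

Lemma descending_coloring (f : nat -> nat) :
  exists c : nat -> bool, forall n, f n < n -> c (f n) = ~~ c n.
Proof.
(* [k] is fuel: the recursion goes from [n] to a smaller [f n], so any fuel above [n] yields the
   same colour. *)
pose col := fix col k n := if k is k'.+1 then
  if f n < n then ~~ col k' (f n) else false else false.
have colE k l n : n < k -> n < l -> col k n = col l n.
  elim: k l n => // k IH [//|l] n nk nl /=; case: ifP => // fn.
  by rewrite (IH l) //; lia.
exists (fun n => col n.+1 n) => n fn.
rewrite [in RHS]/= fn negbK; apply: colE; lia.
Qed.

(* The graph of g is a forest: each component is colored by the parity of the  *)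
(* distance to a chosen representative.                                        *)
Lemma ascending_coloring (g : nat -> nat) : (forall n, n < g n) ->
  exists c : nat -> bool, forall n, c (g n) = ~~ c n.
Proof.
move=> gn.
have ginj i j n : iter i g n = iter j g n -> i = j.
  have lt k m : iter k g m = m -> k = 0.
    have ge : m + k <= iter k g m.
      by elim: k => [|k IH]; [by rewrite addn0|rewrite iterS; have := gn (iter k g m); lia].
    by lia.
  have [ij|/ltnW ij] := leqP i j; rewrite -(subnK ij) iterD.
    by move/esym/lt; lia.
  by move/lt; lia.
pose conn n : set nat := [set r | exists i j, iter i g n = iter j g r].
have connS n : conn (g n) = conn n.
  apply/seteqP; split=> r [i [j E]].
    by exists i.+1, j; rewrite iterSr.
  by exists i, j.+1; rewrite iterS -E -iterSr.
pose even n r := exists i j, iter i g n = iter j g r /\ ~~ odd (i + j).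
exists (fun n => `[< even n (get (conn n)) >]) => n; rewrite connS.
have [i [j E]] : conn n (get (conn n)) by apply: getPex; exists n, 0, 0.
set r := get _ in E *.
apply/idP/idP => [/asboolP[k [l [Ekl kl]]]|].
  apply/asboolP => -[{E}i [{}j [E ij]]].
  (* Both iterates of [g] at [n] reach the same point, since [g^i n = g^j r] and
     [g^(k+1) n = g^l r]; equality of the exponents contradicts the evenness of [i + j] and
     [k + l]. *)
  suff : i + l = k.+1 + j by lia.
  apply: (ginj _ _ n).
  by rewrite addnC iterD E -iterD addnC iterD -Ekl -iterSr -iterD addnC.
move=> /asboolP nev; apply/asboolP.
have oij : odd (i + j) by apply: contrapT => /negP ij; apply: nev; exists i, j.
case: i => [|i] in E oij *.
  exists 0, j.+1; split; last by move: oij => /=; lia.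
  by rewrite /= -E.
by exists i, j; split; [rewrite -iterSr|move: oij => /=; lia].
Qed.

Lemma functional_graph_coloring (f : nat -> nat) : (forall n, f n <> n) ->
  exists c d : nat -> bool, forall n, c (f n) = c n -> d (f n) <> d n.
Proof.
move=> fN; have [c cP] := descending_coloring f.
(* The value [n.+1] only makes the map ascend everywhere; where [f] descends, [c] already
   separates. *)
have [|d dP] := @ascending_coloring (fun n => if n < f n then f n else n.+1).
  by move=> n; case: ifP.
exists c, d => n; have [nf|fn|/esym/fN//] := ltngtP n (f n).
  by have := dP n; rewrite nf => -> _; case: (d n).
by rewrite cP//; case: (c n).
Qed.

Lemma reaping_bool F (c : nat -> bool) : reaping_family F ->
  exists A b N, F A /\ forall x, A x -> N <= x -> c x = b.
Proof.
move=> [Finf Fsplit].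
apply: contrapT => nA; apply: Fsplit; exists [set x | c x] => A FA.
split; apply/infinite_natP => n; apply: contrapT => nx.
  apply: nA; exists A, false, n; split => // x Ax nlex.
  by apply/negP => cx; apply: nx; exists x.
apply: nA; exists A, true, n; split => // x Ax nlex.
by apply/negPn/negP => cx; apply: nx; exists x => //; split => //; exact/negP.
Qed.

Lemma ros01_le_reaping F : reaping_family F ->
  exists2 G, ros01_c0_family G & G #<= F.
Proof.
move=> reapF; have Finf := reaping_infinite reapF.
have /choice[e eP] (A : set nat) :
    exists e : nat -> nat, F A -> (forall n, A (e n)) /\ injective e.
  have [FA|nFA] := pselect (F A); last by exists id.
  by have [e eP] := infinite_enum (reapF.1 _ FA); exists e.
pose sub (q : set nat * set nat * nat) : set nat :=
  (e q.1.1 @` q.1.2) `&` [set x | q.2 <= x].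
exists (sub @` ((F `*` F) `*` [set: nat])); last first.
  apply: card_le_trans (card_image_le _ _) _.
  apply: card_le_trans (card_setX_le Finf).
  apply: card_setX_nat_le; apply: infinite_setX => //.
split=> [_ [[[A B] n] [[/= FA FB] _] <-]|f ff fN].
  have [_ einj] := eP _ FA.
  rewrite /sub /=.
  have : infinite_set (e A @` B).
    rewrite (eq_finite_set (inj_card_eq _)); first exact: reapF.1.
    by move=> x y _ _; exact: einj.
  move=> /infinite_natP inf; apply/infinite_natP => m.
  have [x xB] := inf (maxn m n); exists x; last by lia.
  by split => //=; lia.
have [c [d cd]] := functional_graph_coloring fN.
have [A [b [N [FA AP]]]] := reaping_bool c reapF.
have [B [b' [M [FB BP]]]] := reaping_bool (d \o e A) reapF.
have [eA _] := eP _ FA.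
(* Above [N] the first bit is constant; exceeding [e A i] for all [i < M] forces the index to be at
   least [M], where the second bit is constant. *)
pose K := N + \max_(i < M) (e A i).+1.
have colK x : sub (A, B, K) x -> c x = b /\ d x = b'.
  move=> [[k Bk <-]] /=; rewrite /K => Kle.
  split; first by apply: AP => //; lia.
  apply: BP => //; rewrite leqNgt; apply/negP => kM.
  have : (e A k).+1 <= \max_(i < M) (e A i).+1 by exact: (leq_bigmax (Ordinal kM)).
  by lia.
exists (sub (A, B, K)); first by exists (A, B, K).
apply/seteqP; split=> // y [[x /colK[cx dx] <-] /colK[cfx dfx]].
by apply: (cd x); rewrite ?cfx ?dfx.
Qed.

(** * The lower bound *)

(** Split repeatedly, keeping one half as the next [R n] and discarding the other as [D n]. The
    [D n] are disjoint and each meets every [A] infinitely often; [c] returns the index, or 0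
    outside their union. *)
Lemma split_infinitely (G : set (set nat)) :
  (forall A, G A -> infinite_set A) ->
  (forall R : set nat, (forall A, G A -> infinite_set (A `&` R)) ->
    exists S, forall A, G A ->
      infinite_set (A `&` R `&` S) /\ infinite_set ((A `&` R) `\` S)) ->
  exists c : nat -> nat, forall A p, G A -> infinite_set (A `&` c @^-1` [set p]).
Proof.
move=> Ginf Gsplit.
pose ok R := forall A, G A -> infinite_set (A `&` R).
have /choice[next nextP] (R : set nat) : exists S, ok R -> forall A, G A ->
    infinite_set (A `&` R `&` S) /\ infinite_set ((A `&` R) `\` S).
  have [okR|nokR] := pselect (ok R); last by exists set0.
  by have [S SP] := Gsplit R okR; exists S.
pose R n := iter n (fun R => R `&` next R) setT.
have okR n : ok (R n).
  elim: n => [|n IH] A GA; first by rewrite setIT; exact: Ginf.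
  by rewrite /R iterS -/(R n) setIA; exact: (nextP _ IH A GA).1.
have Rmono i j x : i <= j -> R j x -> R i x.
  elim: j => [|j IH]; first by case: i.
  by rewrite leq_eqVlt => /orP[/eqP->//|/IH iR] []/iR.
pose D n := R n `\` next (R n).
have Duniq i j x : D i x -> D j x -> i = j.
  have lt m n : m < n -> D m x -> ~ D n x.
    by move=> mn [_ nx] [Rnx _]; have [] := Rmono _ _ _ mn Rnx.
  move=> Di Dj; have [ij|ji|//] := ltngtP i j.
    by case: (lt _ _ ij Di).
  by case: (lt _ _ ji Dj).
have /choice[c cP] x : exists n, forall m, D m x -> n = m.
  have [[m Dm]|nD] := pselect (exists m, D m x).
    by exists m => m'; exact: Duniq Dm.
  by exists 0 => m Dm; case: nD; exists m.
exists c => A p GA; apply: sub_infinite_set (nextP _ (okR p) A GA).2.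
by move=> x [[Ax Rx] nx]; split => //=; apply: cP.
Qed.

Lemma ros01_ge G : ros01_c0_family G ->
  (exists2 D, dominating_family D & D #<= G) \/
  (exists2 F, reaping_family F & F #<= G).
Proof.
move=> [Ginf Gros].
have [|nF] := pselect (exists2 F, reaping_family F & F #<= G); first by right.
have [|nD] := pselect (exists2 D, dominating_family D & D #<= G); first by left.
exfalso.
have [|c cP] := split_infinitely Ginf.
  (* If [R] could not be split, the traces of [G] on [R] would form a reaping family no larger than
     [G]. *)
  move=> R GR; apply: contrapT => nS; apply: nF.
  exists [set A `&` R | A in G]; last exact: card_image_le.
  split=> [_ [A GA <-]|[S SP]]; first exact: GR.
  by apply: nS; exists S => A GA; apply: SP; exists A.
have /choice[g gP] (A : set nat) : exists g : nat -> nat, G A ->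
    forall n, [/\ A (g n), A (c (g n)) & n <= c (g n) < g n].
  have [GA|nGA] := pselect (G A); last by exists id.
  have /choice[g gP] n : exists q, [/\ A q, A (c q) & n <= c q < q].
    have [p Ap np] := (infinite_natP A).1 (Ginf _ GA) n.
    have [q [Aq cq] pq] := (infinite_natP _).1 (cP A p GA) p.+1.
    by exists q; rewrite cq; split => //; lia.
  by exists g.
have [h0 h0P] : exists h0, forall A, G A -> exists n, g A n < h0 n.
  apply: contrapT => nh; apply: nD; exists (g @` G); last exact: card_image_le.
  move=> h; apply: contrapT => nf; apply: nh; exists h => A GA.
  apply: contrapT => ng; apply: nf; exists (g A); first by exists A.
  exists 0 => // n _ /=; rewrite leqNgt; apply/negP => ?; by apply: ng; exists n.
(* The truncation of [f] is read at [c (g A n)], known only to be at least [n], so the bound must be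
   monotone. *)
pose h n := \max_(i < n.+1) h0 i.
have hP i n : i <= n -> h0 i <= h n.
  by rewrite -ltnS => im; exact: (leq_bigmax (Ordinal im)).
(* Both branches avoid fixed points, and the fibre over [p] lies below [h p + p + 1]. *)
pose f q := if c q < q <= h (c q) then c q else q.+1.
have [||A GA fA] := Gros f.
- move=> p; apply: sub_finite_set (finite_II (h p + p).+1) => q /=.
  by rewrite /f; case: ifP => [+ <-|_ <-]; lia.
- by move=> q; rewrite /f; case: ifP; lia.
have [n gh] := h0P A GA; have [Ag Acg cg] := gP A GA n.
have : (f @` A `&` A) (c (g A n)).
  split => //; exists (g A n) => //; rewrite /f ifT//.
  by have := hP n (c (g A n)); lia.
by rewrite fA.
Qed.

(** * Existence of the families and comparison of cardinals as classes *)

Lemma dominating_family_nonempty : dominating_family !=set0.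
Proof. by exists setT => g; exists g => //; exists 0 => // n _ /=. Qed.

Lemma reaping_family_nonempty : reaping_family !=set0.
Proof.
exists [set A | infinite_set A]; split=> // -[S SP].
have [Sfin|Sinf] := pselect (finite_set S).
  have [inf _] := SP setT infinite_nat.
  by apply: inf; rewrite setTI.
by have [_ ] := SP S Sinf; rewrite setDv; apply; exact: finite_set0.
Qed.

Lemma cardinality_of_eq T U (A : set T) (B : set U) :
  A #<= B -> B #<= A -> cardinality_of A = cardinality_of B.
Proof.
move=> AB BA; have AeB : A #= B by rewrite card_eq_le AB.
apply/seteqP; split=> X /= XA; first exact: card_eq_trans XA AeB.
by apply: (card_eq_trans XA); rewrite card_eq_sym.
Qed.

(* The library's [set_type A] lives in too large a universe to be an element   *)
(* of a [cardinal], hence the use of [sig].                                    *)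
Lemma cardinality_of_sig T (A : set T) : cardinality_of A {x | A x}.
Proof.
rewrite /cardinality_of /= card_eq_le; apply/andP; split.
  apply: (card_le_of_inj (f := sval)) => [[x Ax]//|[x Ax] [y Ay] _ _ /= xy].
  by subst y; congr exist; exact: Prop_irrelevance.
apply: card_le_trans (card_image_le sval _); apply: subset_card_le => x Ax.
by exists (exist _ x Ax).
Qed.

Lemma cardinality_of_le T U (A : set T) (B : set U) :
  cardinal_le (cardinality_of A) (cardinality_of B) <-> A #<= B.
Proof.
split=> [[X [Y [/= XA YB XY]]]|AB].
  by rewrite -(card_le_eql XA) -(card_le_eqr YB).
have AA := cardinality_of_sig A; have BB := cardinality_of_sig B.
exists {x | A x}, {x | B x}; split => //.
by rewrite (card_le_eql AA) (card_le_eqr BB).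
Qed.

Theorem theorem5p4 : ros01_c0 = cardinal_min dominating_number reaping_number.
Proof.
have [D [domD minD DE]] := min_cardinalityP dominating_family_nonempty.
have [F [reapF minF FE]] := min_cardinalityP reaping_family_nonempty.
have [GD rosGD GDle] := ros01_le_dominating domD.
have [GF rosGF GFle] := ros01_le_reaping reapF.
have [|G [rosG minG GE]] := @min_cardinalityP _ ros01_c0_family.
  by exists GD.
have GleD : G #<= D := card_le_trans (minG _ rosGD) GDle.
have GleF : G #<= F := card_le_trans (minG _ rosGF) GFle.
have geG : D #<= G \/ F #<= G.
  have [[D' domD' D'G]|[F' reapF' F'G]] := ros01_ge rosG.
    by left; exact: card_le_trans (minD _ domD') D'G.
  by right; exact: card_le_trans (minF _ reapF') F'G.
rewrite /ros01_c0 /dominating_number /reaping_number GE DE FE /cardinal_min.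
(* [nat -> Prop] lives in a smaller universe than its synonym [set nat].       *)
have leDF := @cardinality_of_le (nat -> nat) (nat -> Prop) D F.
case: asboolP => [/leDF DF|nDF]; apply: cardinality_of_eq => //.
  by case: geG => // FG; exact: card_le_trans DF FG.
case: geG => // DG; exfalso; apply: nDF; apply/leDF.
exact: card_le_trans DG GleF.
Qed.
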